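(* Let $\mathbb{K}$ be $\mathbb{R}$ or $\mathbb{C}$, let $(X,\|\cdot\|)$ be a Banach space over $\mathbb{K}$, let $p\ge 1$ be an integer and $a_1,\ldots,a_p\in\mathbb{K}$. Suppose that the characteristic equation $r^p=a_1r^{p-1}+a_2r^{p-2}+\cdots+a_p$ has $p$ distinct complex roots $r_1,\ldots,r_p$, and that $|r_k|>1$ for $k=1,\ldots,p$. Put $$K=\frac{1}{|V|}\sum_{s=1}^{\infty}\left|\frac{V_1}{r_1^s}-\frac{V_2}{r_2^s}+\cdots+(-1)^{p+1}\frac{V_p}{r_p^s}\right|,$$ where $V=V(r_1,\ldots,r_p)$ and $V_k=V(r_1,\ldots,r_{k-1},r_{k+1},\ldots,r_p)$, $1\le k\le p$, are Vandermonde determinants. Then for every $\varepsilon>0$ and every sequence $(x_n)_{n\ge 0}$ in $X$ satisfying $$\|x_{n+p}-a_1x_{n+p-1}-\cdots-a_px_n\|\le\varepsilon\quad\text{for all } n\in\mathbb{N},$$ there exists a unique sequence $(y_n)_{n\ge 0}$ in $X$ such that $$y_{n+p}=a_1y_{n+p-1}+\cdots+a_py_n\quad\text{and}\quad \|x_n-y_n\|\le K\varepsilon\quad\text{for all } n\in\mathbb{N}.$$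
   Context: $\mathbb{N}=\{0,1,2,\ldots\}$. The Vandermonde determinant of complex numbers $t_1,\ldots,t_m$ is $V(t_1,\ldots,t_m)=\det\big(t_j^{\,i-1}\big)_{1\le i,j\le m}=\prod_{1\le i<j\le m}(t_j-t_i)$, with the value $1$ when $m=0$ or $m=1$. The list in $V_k$ is $(r_1,\ldots,r_p)$ with $r_k$ omitted and the order of the other entries preserved. When $\mathbb{K}=\mathbb{R}$ the coefficients $a_i$ are real but the roots $r_k$ may be non-real complex numbers. *)

(* Defs.v *)
From mathcomp Require Import all_boot all_order all_algebra.
From mathcomp.real_closed Require Import complex.
From mathcomp Require Import all_classical all_reals all_analysis.

Set Implicit Arguments.
Unset Strict Implicit.
Unset Printing Implicit Defensive.

Import Order.TTheory GRing.Theory Num.Theory.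
Import numFieldNormedType.Exports.

Local Open Scope ring_scope.
Local Open Scope complex_scope.

Inductive scalar_kind := RealScalars | ComplexScalars.

Definition scalar_field (R : realType) (c : scalar_kind) : numFieldType :=
  match c with RealScalars => R | ComplexScalars => R[i] end.

Definition to_complex (R : realType) (c : scalar_kind) : scalar_field R c -> R[i] :=
  match c with RealScalars => real_complex R | ComplexScalars => id end.

(* The norm of a [completeNormedModType F] takes its values in [F] itself; over
   [R[i]] these values are nonnegative, hence real. *)
Definition real_norm (R : realType) (c : scalar_kind)
    (X : completeNormedModType (scalar_field R c)) (x : X) : R :=
  complex.Re (to_complex `|x|).

(* [Vandermonde m t] has entry [t_j ^+ i] in row [i], column [j], from 0. *)
Definition vandermonde_det (R : realType) (m : nat) (t : 'rV[R[i]]_m) : R[i] :=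
  \det (Vandermonde m t).

(* Indices start at 0: [a i] is the coefficient a_(i+1). *)
Definition char_root (R : realType) (c : scalar_kind) (p : nat)
    (a : 'I_p -> scalar_field R c) (z : R[i]) : Prop :=
  z ^+ p = \sum_(i < p) to_complex (a i) * z ^+ (p - i.+1).

(* [col' k r] is [r] with entry [k] omitted; the sign (-1)^(k+1) for k counted
   from 1 is [(-1) ^+ k] for k counted from 0. The series is a [limn] of partial
   sums, meaningful when it converges, e.g. when all |r_k| > 1. *)
Definition stability_constant (R : realType) (p : nat) (r : 'rV[R[i]]_p) : R :=
  (Normc.normc (vandermonde_det r))^-1 *
  \big[+%R/0]_(1 <= s <oo)
    Normc.normc (\sum_(k < p) (-1) ^+ k * vandermonde_det (col' k r) / r 0 k ^+ s).

(* Main.v *)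
Require Import Defs.
From HB Require Import structures.
From mathcomp Require Import all_boot all_order all_algebra.
From mathcomp.real_closed Require Import complex.
From mathcomp Require Import all_classical all_reals all_analysis.

Import Order.TTheory GRing.Theory Num.Theory.
Import numFieldNormedType.Exports.
Local Open Scope ring_scope.
Local Open Scope complex_scope.

(* Let [b n] be the defect of [x] in the recurrence.  With the weights
   [w k = (-1)^(p-1+k) V_k / V], which solve the Vandermonde system
   [sum_k w k * r_k^m = (m == p-1)] for [m < p], the numbers
   [f m = sum_k w k * r_k^(p-1-m)] satisfy [f 0 = 1], [f m = 0] for [0 < m < p]
   and [f m = sum_i a_i f (m+i+1)].  They lie in the scalar field, since the
   recurrence can be solved backwards, and the sum of [|f (m+p)|] over [m >= 0]
   is the stability constant.  For a bounded sequence [b] the sums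
   [G b n = sum_m f (m+p) b (n+m)] satisfy
   [sum_i a_i G b (n+p-i-1) = b n + G b (n+p)], so [y = x + G b] solves the
   recurrence.  If [d] is a bounded solution of the
   homogeneous recurrence then so is [G d], and the same identity for [d] gives
   [d = 0]: this is uniqueness. *)

(** * The modulus on [R[i]] *)

Lemma normc_ge0 (R : rcfType) (z : R[i]) : 0 <= Normc.normc z.
Proof. by case: z => x y; exact: sqrtr_ge0. Qed.

Lemma normc_sum (R : rcfType) (I : Type) (s : seq I) (P : pred I) (F : I -> R[i]) :
  Normc.normc (\sum_(i <- s | P i) F i) <= \sum_(i <- s | P i) Normc.normc (F i).
Proof.
elim/big_ind2: _ => [|x t y u xt yu|//]; first by rewrite Normc.normc0.
by apply: le_trans (le_normcD _ _) _; exact: lerD.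
Qed.

Lemma normcX (R : rcfType) (z : R[i]) (n : nat) :
  Normc.normc (z ^+ n) = Normc.normc z ^+ n.
Proof.
by elim: n => [|n IH]; rewrite ?Normc.normc1// !exprS Normc.normcM IH.
Qed.

(** * Embedding of the scalars in [R[i]], and the real-valued norm of [X] *)

Section ScalarField.
Variables (R : realType) (c : scalar_kind).
Local Notation F := (scalar_field R c).

Fact to_complex_is_zmod_morphism : zmod_morphism (@to_complex R c).
Proof. by case: c => x y //=; rewrite rmorphB. Qed.

Fact to_complex_is_monoid_morphism : monoid_morphism (@to_complex R c).
Proof. by case: c; split=> // x y /=; rewrite rmorphM. Qed.

HB.instance Definition _ := GRing.isZmodMorphism.Build F R[i] (@to_complex R c)
  to_complex_is_zmod_morphism.
HB.instance Definition _ := GRing.isMonoidMorphism.Build F R[i] (@to_complex R c)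
  to_complex_is_monoid_morphism.

Lemma to_complex_le (a b : F) : (to_complex a <= to_complex b) = (a <= b).
Proof. by case: c a b => //= a b; rewrite lecR. Qed.

Lemma to_complex_lt (a b : F) : (to_complex a < to_complex b) = (a < b).
Proof. by case: c a b => //= a b; rewrite ltcR. Qed.

Lemma to_complex_norm (a : F) : to_complex `|a| = (Normc.normc (to_complex a))%:C.
Proof. by case: c a => //= a; rewrite expr0n addr0 sqrtr_sqr. Qed.

(** Comparable elements of [R[i]] have equal imaginary parts, so a nonnegative one is real. *)
Lemma to_complex_ge0 (a : F) : 0 <= a ->
  to_complex a = (complex.Re (to_complex a))%:C.
Proof.
rewrite -to_complex_le rmorph0; case: (to_complex a) => x y.
by rewrite lecE /= => /andP[/eqP-> _].
Qed.

Variable X : completeNormedModType F.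
Implicit Types (x y : X) (u : nat -> X).

Lemma real_normE x : (real_norm x)%:C = to_complex `|x|.
Proof. by rewrite [RHS]to_complex_ge0. Qed.

Lemma real_norm_le x (e : F) : 0 <= e ->
  (`|x| <= e) = (real_norm x <= complex.Re (to_complex e)).
Proof.
by move=> e0; rewrite -to_complex_le -real_normE (to_complex_ge0 _ e0) lecR.
Qed.

Lemma real_norm_lt x (e : F) : 0 < e ->
  (`|x| < e) = (real_norm x < complex.Re (to_complex e)).
Proof.
by move=> e0; rewrite -to_complex_lt -real_normE (to_complex_ge0 _ (ltW e0)) ltcR.
Qed.

Lemma real_norm_ge0 x : 0 <= real_norm x.
Proof.
by rewrite -lecR real_normE rmorph0 -(rmorph0 (@to_complex R c)) to_complex_le.
Qed.

Lemma real_norm0 : real_norm (0 : X) = 0.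
Proof. by rewrite /real_norm normr0 rmorph0. Qed.

Lemma real_norm_le0 x : real_norm x <= 0 -> x = 0.
Proof.
by move=> x0; apply/eqP; rewrite -normr_le0 real_norm_le// rmorph0.
Qed.

Lemma real_normD x y : real_norm (x + y) <= real_norm x + real_norm y.
Proof.
by rewrite -lecR rmorphD /= !real_normE -rmorphD to_complex_le ler_normD.
Qed.

Lemma real_normN x : real_norm (- x) = real_norm x.
Proof. by rewrite /real_norm normrN. Qed.

Lemma real_normZ (a : F) x :
  real_norm (a *: x) = Normc.normc (to_complex a) * real_norm x.
Proof.
apply: complexI; rewrite rmorphM /= !real_normE normrZ rmorphM.
by congr (_ * _); exact: to_complex_norm.
Qed.

Lemma real_norm_sum (m n : nat) u :
  real_norm (\sum_(m <= k < n) u k) <= \sum_(m <= k < n) real_norm (u k).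
Proof.
elim/big_ind2: _ => [|x s y t xs yt|//]; first by rewrite real_norm0.
by apply: le_trans (real_normD _ _) _; exact: lerD.
Qed.


Local Open Scope classical_set_scope.

(** Completeness turns absolute convergence into convergence: blocks of the series are dominated by
    those of a bounded nondecreasing real series, which is Cauchy. *)
Lemma summable_is_cvgn u (C : R) :
  (forall M : nat, \sum_(0 <= m < M) real_norm (u m) <= C) -> cvgn (series u).
Proof.
move=> uC; apply/cauchy_cvgP/cauchy_seriesP => e e0.
have /cauchy_cvgP/cauchy_seriesP : cvgn (series (fun m => real_norm (u m))).
  apply: nondecreasing_is_cvgn; last by exists C => _ [M _ <-]; exact: uC.
  by apply: nondecreasing_series => m _ _; exact: real_norm_ge0.
have e'0 : 0 < complex.Re (to_complex e).
  rewrite -ltcR -to_complex_ge0 ?ltW// rmorph0.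
  by rewrite -(rmorph0 (@to_complex R c)) to_complex_lt.
move=> /(_ _ e'0); apply: filterS => -[m n] /= vmn.
rewrite real_norm_lt//; apply: le_lt_trans (real_norm_sum _ _ _) _.
exact: le_lt_trans (ler_norm _) vmn.
Qed.

Lemma real_norm_lim_series u (C : R) (l : X) :
  (forall M : nat, \sum_(0 <= m < M) real_norm (u m) <= C) ->
  series u @ \oo --> l -> real_norm l <= C.
Proof.
move=> uC ul; apply/ler_addgt0Pr => e e0.
(* The radius in [cvgrPdist_le] must lie in [F], so [e] is first transported there. *)
have [e' e'0 e'E] : exists2 e' : F, 0 < e' & complex.Re (to_complex e') = e.
  by case: (c) => /=; [exists e|exists e%:C => //; rewrite ltcR].
move/cvgrPdist_le : ul => /(_ _ e'0) [M _ /(_ M (leqnn M))] /=.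
rewrite (real_norm_le _ _ (ltW e'0)) e'E => uM.
rewrite -(subrK (series u M) l) addrC; apply: le_trans (real_normD _ _) _.
by apply: lerD => //; apply: le_trans (real_norm_sum _ _ _) _.
Qed.

End ScalarField.

(** * The operator [G] and its identities *)

Section Green.
Local Open Scope classical_set_scope.
Variables (R : realType) (c : scalar_kind).
Variables (X : completeNormedModType (scalar_field R c)) (p : nat).
Variables (a : 'I_p -> scalar_field R c) (f : nat -> scalar_field R c) (S : R).
Hypothesis f0 : f 0%N = 1.
Hypothesis f_vanish : forall m : nat, (0 < m < p)%N -> f m = 0.
Hypothesis f_rec : forall m : nat, f m = \sum_(i < p) a i * f (m + i.+1)%N.
Hypothesis f_sum : forall M : nat,
  \sum_(0 <= m < M) Normc.normc (to_complex (f (m + p)%N)) <= S.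
Implicit Types (b : nat -> X) (q n : nat).

(** The case [q = p] is the operator [G]; a free [q] allows [G] to be reached by moving the offset
    one step at a time. *)
Definition green_sum b q n : X :=
  limn (series (fun m => f (m + q)%N *: b (n + m)%N)).

Lemma green_sum_cvg b (B : R) q n : (forall n, real_norm (b n) <= B) ->
  series (fun m => f (m + q)%N *: b (n + m)%N) @ \oo --> green_sum b q n.
Proof.
move=> bB; have B0 : 0 <= B by exact: le_trans (real_norm_ge0 _ _ _ _) (bB 0%N).
pose g m := Normc.normc (to_complex (f m)).
have g0 m : 0 <= g m by exact: normc_ge0.
apply: (@summable_is_cvgn _ _ _ _ ((\sum_(0 <= m < p) g m + S) * B)) => M.
have sum_shift k N : \sum_(0 <= m < N) g (m + k)%N = \sum_(k <= m < N + k) g m.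
  by rewrite (big_addn 0 (N + k) k xpredT g) addnK.
apply: (@le_trans _ _ (\sum_(0 <= m < M) g (m + q)%N * B)).
  apply: ler_sum => m _; rewrite real_normZ; apply: ler_wpM2l; [exact: g0|exact: bB].
rewrite -mulr_suml; apply: ler_wpM2r => //.
(* The range [[0, M + q + p)] contains [[q, M + q)] and can be cut at [p]: the head is a fixed
   finite sum, the tail is at most [S]. *)
apply: (@le_trans _ _ (\sum_(0 <= m < M + q + p) g m)).
  rewrite sum_shift [leRHS](@big_cat_nat _ _ _ q) ?leq0n// -?addnA
    ?(leq_trans (leq_addl M q)) ?leq_add2l ?leq_addr //=.
  rewrite -[leLHS]add0r; apply: lerD; first exact: sumr_ge0.
  rewrite [leRHS](@big_cat_nat _ _ _ (M + q)) ?leq_addl ?leq_add2l ?leq_addr //=.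
  by rewrite lerDl sumr_ge0.
rewrite (@big_cat_nat _ _ _ p) ?leq_addl//= lerD2l -sum_shift; exact: f_sum.
Qed.

Lemma green_sum_le b (B : R) n : (forall n, real_norm (b n) <= B) ->
  real_norm (green_sum b p n) <= S * B.
Proof.
move=> bB; have B0 : 0 <= B by exact: le_trans (real_norm_ge0 _ _ _ _) (bB 0%N).
apply: real_norm_lim_series (green_sum_cvg _ _ _ _ bB) => M.
apply: le_trans (ler_wpM2r B0 (f_sum M)).
rewrite mulr_suml; apply: ler_sum => m _.
rewrite real_normZ; apply: ler_wpM2l => //; exact: normc_ge0.
Qed.

(** Splits off the term [m = 0] of the series. *)
Lemma green_sum_rec b (B : R) q n : (forall n, real_norm (b n) <= B) ->
  green_sum b q n = f q *: b n + green_sum b q.+1 n.+1.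
Proof.
move=> bB; apply: cvg_lim; first exact: norm_hausdorff.
rewrite -cvg_shiftS /=.
apply: cvg_trans (cvgD (cvg_cst (f q *: b n)) (green_sum_cvg _ _ q.+1 n.+1 bB)).
apply: near_eq_cvg; apply: nearW => M /=.
rewrite /series /= big_nat_recl// addn0 add0n; congr (_ + _).
apply: eq_bigr => m _.
by rewrite addSn !addnS addSn.
Qed.

(** For [0 < j < p] the split-off term vanishes with [f j], so offset and argument increase together
    until the offset is [p]. *)
Lemma green_sum_shift b (B : R) n (i : 'I_p) : (forall n, real_norm (b n) <= B) ->
  green_sum b i.+1 n = green_sum b p (n + (p - i.+1))%N.
Proof.
move=> bB; have : (0 < i.+1)%N by [].
move: (ltn_ord i); move: i.+1 => j.
have [k] := ubnP (p - j)%N; elim: k j n => // k IH j n pjk jp j0.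
move: jp; rewrite leq_eqVlt => /orP[/eqP->|jp]; first by rewrite subnn addn0.
rewrite (green_sum_rec _ _ _ _ bB) f_vanish ?j0// scale0r add0r IH//.
  by rewrite addSnnS subnSK.
by rewrite -ltnS (leq_trans _ pjk)// ltnS subnS prednK ?subn_gt0.
Qed.

(** After [green_sum_shift] the left side has coefficients [\sum_i a i * f (m + i.+1) = f m], so it
    equals [green_sum b 0 n]; splitting off its first term, where [f 0 = 1], gives the right
    side. *)
Lemma green_sum_char b (B : R) n : (0 < p)%N -> (forall n, real_norm (b n) <= B) ->
  \sum_(i < p) a i *: green_sum b p (n + (p - i.+1))%N =
  b n + green_sum b p (n + p)%N.
Proof.
move=> p0 bB.
have -> : (n + p = n.+1 + (p - 1))%N by rewrite addSnnS subn1 prednK.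
rewrite -(green_sum_shift b B n.+1 (Ordinal p0)) //= -[b n]scale1r -f0.
rewrite -(green_sum_rec _ _ _ _ bB).
apply/esym/cvg_lim; first exact: norm_hausdorff.
have /(_ _) cv : forall i : 'I_p, true ->
    a i *: series (fun m => f (m + i.+1)%N *: b (n + m)%N) M @[M --> \oo] -->
    a i *: green_sum b p (n + (p - i.+1))%N.
  move=> i _; rewrite -(green_sum_shift b B)//; apply: cvgZl_tmp.
  exact: green_sum_cvg bB.
apply: cvg_trans (cvg_big _ _ cv); last exact: add_continuous.
apply: near_eq_cvg; apply: nearW => M /=.
rewrite /series /=; under eq_bigr do rewrite scaler_sumr.
rewrite exchange_big /=; apply: eq_bigr => m _.
by rewrite addn0 f_rec scaler_suml; apply: eq_bigr => i _; rewrite scalerA.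
Qed.

(** The series commutes with translation in [n], so a linear recurrence for [b] passes to it term by
    term. *)
Lemma green_sum_homogeneous b (B : R) q n : (forall n, real_norm (b n) <= B) ->
  (forall n, b (n + p)%N = \sum_(i < p) a i *: b (n + (p - i.+1))%N) ->
  green_sum b q (n + p) = \sum_(i < p) a i *: green_sum b q (n + (p - i.+1)).
Proof.
move=> bB b_rec; apply: cvg_lim; first exact: norm_hausdorff.
have /(_ _) cv : forall i : 'I_p, true ->
    a i *: series (fun m => f (m + q)%N *: b (n + (p - i.+1) + m)%N) M
      @[M --> \oo] --> a i *: green_sum b q (n + (p - i.+1))%N.
  by move=> i _; apply: cvgZl_tmp; exact: green_sum_cvg bB.
apply: cvg_trans (cvg_big _ _ cv); last exact: add_continuous.
apply: near_eq_cvg; apply: nearW => M /=.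
rewrite /series /=; under eq_bigr do rewrite scaler_sumr.
rewrite exchange_big /=; apply: eq_bigr => m _.
rewrite addnAC b_rec scaler_sumr; apply: eq_bigr => i _.
by rewrite !scalerA mulrC addnAC.
Qed.

End Green.
Arguments green_sum {R c X} f b q n.

(** * The coefficients [f], built from the roots *)

Section GreenCoefficients.
Variables (R : realType) (c : scalar_kind) (p' : nat).
Local Notation p := p'.+1.
Variables (a : 'I_p -> scalar_field R c) (r : 'rV[R[i]]_p).
Hypothesis r_root : forall k : 'I_p, char_root a (r 0 k).
Hypothesis r_distinct : injective (fun k : 'I_p => r 0 k).
Hypothesis r_gt1 : forall k : 'I_p, 1 < Normc.normc (r 0 k).

Lemma vandermonde_det_neq0 : vandermonde_det r != 0.
Proof.
rewrite /vandermonde_det det_Vandermonde prodf_seq_neq0; apply/allP => i _ /=.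
rewrite prodf_seq_neq0; apply/allP => j _; apply/implyP => ij.
by rewrite subr_eq0; apply: contraTneq ij => /r_distinct ->; rewrite ltnn.
Qed.

Lemma root_neq0 k : r 0 k != 0.
Proof.
by apply: contraTneq (r_gt1 k) => ->; rewrite Normc.normc0 ltr10.
Qed.

(** These are the entries of the last column of the inverse Vandermonde matrix. *)
Definition vandermonde_weight (k : 'I_p) : R[i] :=
  (-1) ^+ (p' + k) * vandermonde_det (col' k r) / vandermonde_det r.

(** Reads the last column of [V * adj V = det V], divided by the determinant. *)
Lemma vandermonde_weight_moment (m : nat) : (m < p)%N ->
  \sum_k r 0 k ^+ m * vandermonde_weight k = (m == p')%:R.
Proof.
move=> mp; have := congr1 (fun A : 'M[R[i]]_(p, p) => A (Ordinal mp) ord_max)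
  (mul_mx_adj (Vandermonde p r)).
rewrite !mxE => E.
have -> : (m == p')%:R =
    (vandermonde_det r *+ (Ordinal mp == ord_max)) / vandermonde_det r.
  by rewrite -[LHS](mulfK vandermonde_det_neq0) mulr_natl.
rewrite -E mulr_suml; apply: eq_bigr => k _.
rewrite !mxE -mulrA; congr (_ * (_ * _ / _)).
(* Deleting the last row leaves the exponents [0, ..., p' - 1], so the minor is again a Vandermonde
   matrix, in the remaining roots. *)
congr (\det _); apply/matrixP => i j; rewrite !mxE; congr (_ ^+ _).
by rewrite /= /bump leqNgt ltn_ord.
Qed.

Definition green_coef (m : nat) : R[i] :=
  \sum_k vandermonde_weight k * r 0 k ^+ p' / r 0 k ^+ m.

(** For [m <= p'] the exponent [p' - m] is a natural number, and the sum is a moment of the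
    weights. *)
Lemma green_coef_small (m : nat) : (m <= p')%N -> green_coef m = (m == 0)%:R.
Proof.
move=> mp; transitivity (\sum_k r 0 k ^+ (p' - m) * vandermonde_weight k).
  apply: eq_bigr => k _; rewrite -mulrA mulrC; congr (_ * _).
  by rewrite -expfB_cond// (negbTE (root_neq0 k)).
rewrite vandermonde_weight_moment ?ltnS ?leq_subr//.
congr (nat_of_bool _)%:R.
by rewrite -(eqn_add2r m) subnK// -{1}[p']addn0 eqn_add2l eq_sym.
Qed.

(** Each root contributes its characteristic equation divided by [r 0 k ^+ (m + p)]. *)
Lemma green_coef_rec (m : nat) :
  green_coef m = \sum_(i < p) to_complex (a i) * green_coef (m + i.+1).
Proof.
under [RHS]eq_bigr do rewrite mulr_sumr.
rewrite exchange_big; apply: eq_bigr => k _ /=.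
under eq_bigr do rewrite mulrCA.
rewrite -mulr_sumr; congr (_ * _).
have rm : r 0 k ^+ (m + p) != 0 by rewrite expf_neq0// root_neq0.
apply: (mulIf rm); rewrite mulr_suml {1}exprD mulKf ?expf_neq0 ?root_neq0//.
rewrite (r_root k); apply: eq_bigr => i _; rewrite -mulrA; congr (_ * _).
have -> : (m + p = m + i.+1 + (p - i.+1))%N by rewrite -addnA subnKC.
by rewrite (exprD _ (m + i.+1)) mulKf// expf_neq0// root_neq0.
Qed.

Lemma green_coef_descends : exists f : nat -> scalar_field R c,
  forall m, to_complex (f m) = green_coef m.
Proof.
suff F (m : nat) : exists t : scalar_field R c, to_complex t = green_coef m.
  by have [f fE] := choice F; exists f.
(* In the recurrence at index 0 only the last summand survives; hence the last coefficient is
   invertible. *)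
have ap : to_complex (a ord_max) * green_coef p = 1.
  rewrite -[1](green_coef_small 0 (leq0n p')).
  rewrite [RHS]green_coef_rec big_ord_recr /= big1 ?add0r// => i _.
  by rewrite green_coef_small ?mulr0//= add0n.
have an0 : to_complex (a ord_max) != 0.
  by apply/eqP => a0; move/eqP: ap; rewrite a0 mul0r eq_sym oner_eq0.
have [N] := ubnP m; elim: N m => // N IH m mN.
have [mp|pm] := leqP m p'.
  by exists (m == 0)%:R; rewrite rmorph_nat green_coef_small.
(* The guard [k < m] sits under the existential, with default 0, so that [choice] yields a total
   function. *)
have F k : exists t : scalar_field R c, (k < m)%N -> to_complex t = green_coef k.
  case: (ltnP k m) => [km|]; last by exists 0.
  by have [t] := IH k (leq_trans km mN); exists t.
have {F} [g gE] := choice F.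
(* The recurrence at index [m - p], solved for its last term, which has index [m]. *)
exists ((g (m - p)%N - \sum_(i < p') a (widen_ord (leqnSn p') i) *
  g (m - p + i.+1)%N) / a ord_max).
rewrite fmorph_div rmorphB rmorph_sum /= gE; last first.
  by rewrite ltn_subrL (leq_trans _ pm).
rewrite green_coef_rec big_ord_recr /= subnK//.
apply/(canLR (mulfK an0))/eqP; rewrite subr_eq addrC mulrC; apply/eqP; congr (_ + _).
apply: eq_bigr => i _; rewrite rmorphM /= gE//.
by rewrite -[ltnRHS](subnK pm) ltn_add2l ltnS.
Qed.

(** Up to the sign [(-1) ^+ p'], [green_coef (m + p)] is the term [s = m + 1] of the defining series
    divided by [V]. Partial sums are below the limit once the series is known to converge. *)
Lemma sum_normc_green_coef_le (M : nat) :
  \sum_(0 <= m < M) Normc.normc (green_coef (m + p)) <= stability_constant r.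
Proof.
pose V k := vandermonde_det (col' k r).
pose v s := Normc.normc (\sum_(k < p) (-1) ^+ k * V k / r 0 k ^+ s).
have vE m : Normc.normc (green_coef (m + p)) =
    (Normc.normc (vandermonde_det r))^-1 * v m.+1.
  have -> : green_coef (m + p) =
      (-1) ^+ p' * (vandermonde_det r)^-1 *
      \sum_(k < p) (-1) ^+ k * V k / r 0 k ^+ m.+1.
    rewrite mulr_sumr; apply: eq_bigr => k _.
    rewrite -mulrA -addSnnS (exprD _ m.+1) invfM [X in _ * X]mulrCA.
    rewrite mulfV; last by rewrite expf_neq0// root_neq0.
    rewrite mulr1 /vandermonde_weight exprD -/(V k).
    by rewrite [RHS]mulrA; congr (_ / _); rewrite mulrACA !mulrA [RHS]mulrAC.
  by rewrite !Normc.normcM Normc.normcV normcX normcN Normc.normc1 expr1n mul1r.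
under eq_bigr do rewrite vE.
rewrite -mulr_sumr; apply: ler_wpM2l; first by rewrite invr_ge0 normc_ge0.
have v0 s : 0 <= v s by exact: normc_ge0.
have -> : \sum_(0 <= m < M) v m.+1 = \sum_(1 <= s < M.+1) v s by rewrite big_add1.
apply: (@nondecreasing_cvgn_le _ (fun N => \sum_(1 <= s < N) v s)).
  apply/nondecreasing_seqP => -[|N]; first by rewrite !big_geq.
  by rewrite [leRHS]big_nat_recr//= lerDl.
apply: nondecreasing_is_cvgn.
  apply/nondecreasing_seqP => -[|N]; first by rewrite !big_geq.
  by rewrite [leRHS]big_nat_recr//= lerDl.
(* Sum of the geometric series with ratios [1 / |r_k| < 1], started at [s = 0]. *)
exists (\sum_(k < p) Normc.normc (V k) / (1 - (Normc.normc (r 0 k))^-1)).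
move=> _ [N _ <-].
apply: (@le_trans _ _ (\sum_(0 <= s < N) v s)).
  case: N => [|N]; first by rewrite !big_geq.
  by rewrite [leRHS]big_nat_recl// big_add1 lerDr.
apply: (@le_trans _ _ (\sum_(0 <= s < N) \sum_(k < p)
    Normc.normc (V k) * (Normc.normc (r 0 k))^-1 ^+ s)).
  apply: ler_sum => s _; apply: le_trans (normc_sum _ _ _ _ _) _.
  apply: ler_sum => k _; rewrite !Normc.normcM Normc.normcV !normcX.
  by rewrite normcN Normc.normc1 expr1n mul1r exprVn.
rewrite exchange_big; apply: ler_sum => k _ /=.
have r0 : 0 < Normc.normc (r 0 k) by apply: lt_trans (r_gt1 k).
apply: (@geometric_le_lim _ N); rewrite ?normc_ge0 ?invr_gt0//.
by rewrite ger0_norm ?invr_ge0 ?ltW// invf_lt1.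
Qed.

End GreenCoefficients.

(** * Existence and uniqueness of the nearby solution *)

Theorem theorem2p3 (R : realType) (c : scalar_kind)
    (X : completeNormedModType (scalar_field R c))
    (p : nat) (hp : (1 <= p)%N) (a : 'I_p -> scalar_field R c)
    (r : 'rV[R[i]]_p)
    (r_root : forall k : 'I_p, char_root a (r 0 k))
    (r_distinct : injective (fun k : 'I_p => r 0 k))
    (r_gt1 : forall k : 'I_p, 1 < Normc.normc (r 0 k))
    (eps : R) (heps : 0 < eps) (x : nat -> X)
    (hx : forall n : nat,
      real_norm (x (n + p)%N - \sum_(i < p) a i *: x (n + (p - i.+1))%N) <= eps) :
  exists! y : nat -> X,
    (forall n : nat, y (n + p)%N = \sum_(i < p) a i *: y (n + (p - i.+1))%N) /\
    (forall n : nat, real_norm (x n - y n) <= stability_constant r * eps).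
Proof.
case: p hp a r r_root r_distinct r_gt1 hx => // p' {}hp {}a {}r root dist gt1 hx'.
have [f fE] := green_coef_descends _ _ _ _ _ root dist gt1.
have f0 : f 0%N = 1.
  apply: (fmorph_inj (@to_complex R c)).
  by rewrite /= fE (green_coef_small _ _ _ dist gt1)// eqxx [RHS]rmorph1.
have f_vanish m : (0 < m < p'.+1)%N -> f m = 0.
  move=> /andP[m0 mp]; apply: (fmorph_inj (@to_complex R c)).
  by rewrite /= fE (green_coef_small _ _ _ dist gt1)// gtn_eqF// [RHS]rmorph0.
have f_rec m : f m = \sum_(i < p'.+1) a i * f (m + i.+1)%N.
  apply: (fmorph_inj (@to_complex R c)); rewrite /= fE (green_coef_rec _ _ _ _ _ root gt1).
  rewrite rmorph_sum; apply: eq_bigr => i _ /=.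
  by rewrite [RHS]rmorphM /= fE.
have f_sum M : \sum_(0 <= m < M) Normc.normc (to_complex (f (m + p'.+1)%N)) <=
    stability_constant r.
  by under eq_bigr do rewrite fE; exact: sum_normc_green_coef_le gt1 _.
pose b n := x (n + p'.+1)%N - \sum_(i < p'.+1) a i *: x (n + (p'.+1 - i.+1))%N.
pose y n := x n + green_sum f b p'.+1 n.
have green_char := green_sum_char _ _ X _ _ _ _ f0 f_vanish f_rec f_sum.
(* The recurrence applied to [x] gives [x (n + p) - b n], and applied to [G b] it gives
   [b n + G b (n + p)]; the defects cancel. *)
have y_rec n : y (n + p'.+1)%N = \sum_(i < p'.+1) a i *: y (n + (p'.+1 - i.+1))%N.
  under eq_bigr do rewrite scalerDr.
  by rewrite big_split /= (green_char b _ n isT hx')// addrA [X in _ = X + _]addrC subrK.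
have y_near n : real_norm (x n - y n) <= stability_constant r * eps.
  by rewrite opprD addNKr real_normN; exact: green_sum_le f_sum _ _ _ hx'.
exists y; split=> // z [z_rec z_near].
pose d n := y n - z n.
(* Both solutions stay within the stability bound of [x], hence the factor 2; boundedness makes the
   series for [d] converge. *)
have d_bounded n : real_norm (d n) <= stability_constant r * eps *+ 2.
  rewrite /d -(subrK (x n) (y n)) -addrA; apply: le_trans (real_normD _ _ _ _ _) _.
  by rewrite mulr2n lerD// -real_normN opprB.
have d_rec n : d (n + p'.+1)%N = \sum_(i < p'.+1) a i *: d (n + (p'.+1 - i.+1))%N.
  by rewrite /d y_rec z_rec -sumrB; apply: eq_bigr => i _; rewrite scalerBr.
apply/funext => n; apply/eqP; rewrite -subr_eq0 -/(d n); apply/eqP.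
(* The recurrence applied to [G d] equals both [d n + G d (n + p)] and [G d (n + p)], so
   [d n = 0]. *)
have := green_char d _ n isT d_bounded.
rewrite (green_sum_homogeneous _ _ _ _ _ _ _ f_sum _ _ _ _ d_bounded d_rec).
by move=> /esym/eqP; rewrite -subr_eq0 addrK => /eqP.
Qed.
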